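(* Let $n \geq 4$ be an integer and let $\ell$ be an arbitrary integer with $\ell \geq 2n-1$. Given two vertices $w_{0}, w_{\ell+1}$ (not necessarily distinct) of the odd graph $O_{n}$ and elements $\lambda_{1}, \lambda_{2} \in \{1, 2, \dots, 2n-1\}$ with $\lambda_{1} \notin [w_{0}]$ and $\lambda_{2} \notin [w_{\ell+1}]$, there exists an $(\ell+1)$-special walk from $w_{0}$ to $w_{\ell+1}$ such that its first edge is labeled with $\lambda_{1}$ and its last edge is labeled with $\lambda_{2}$.
   Context: The odd graph $O_{n}$ has one vertex for each $(n-1)$-element subset of $\{1, 2, \dots, 2n-1\}$, and two vertices are adjacent if and only if the corresponding subsets are disjoint. For a vertex $v$ of $O_n$, $[v]$ denotes the corresponding subset. Each edge $uv$ is labeled with the unique element of $\{1, \dots, 2n-1\}$ contained in neither $[u]$ nor $[v]$. A walk of length $k$ from $v_0$ to $v_k$ is a sequence of vertices $v_0 v_1 \dots v_k$ with consecutive vertices adjacent (vertices and edges may repeat); its edges are $v_0v_1, v_1v_2, \dots, v_{k-1}v_k$. A special walk is a walk in which every two consecutive edges are distinct. A $k$-special walk is a special walk of length $k$. *)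

(* Defs.v *)
From mathcomp Require Import all_boot.

Set Implicit Arguments.
Unset Strict Implicit.
Unset Printing Implicit Defensive.

(* The ground set {1, ..., 2n-1} is rendered as 'I_(2 * n - 1), that is,     *)
(* as {0, ..., 2n-2}.                                                         *)
Definition odd_vertex (n : nat) : Type :=
  {A : {set 'I_(2 * n - 1)} | #|A| == n - 1}.

Definition vset (n : nat) (v : odd_vertex n) : {set 'I_(2 * n - 1)} := val v.

Definition odd_adj (n : nat) : rel (odd_vertex n) :=
  fun u v => [disjoint vset u & vset v].

(* Edges are undirected: uv is the unordered pair [set u; v].                 *)
Definition edge (n : nat) (u v : odd_vertex n) : {set odd_vertex n} :=
  [set u; v].

(* a is the only element of the ground set lying in no endpoint of e.        *)
Definition edge_labeled (n : nat) (e : {set odd_vertex n})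
    (a : 'I_(2 * n - 1)) : bool :=
  ~: (\bigcup_(v in e) vset v) == [set a].

Lemma edge_labeled_unique (n : nat) (u v : odd_vertex n) :
  0 < n -> odd_adj u v -> exists! a, edge_labeled (edge u v) a.
Proof.
move=> n_gt0 /[dup] dis; rewrite /odd_adj -setI_eq0 => /eqP uv0.
have Eb : \bigcup_(x in edge u v) vset x = vset u :|: vset v.
  apply/setP=> i; apply/bigcupP/setUP => [[x /set2P[]-> xi]|[ui|vi]].
  - by left.
  - by right.
  - by exists u; rewrite // set21.
  - by exists v; rewrite // set22.
have : #|~: (vset u :|: vset v)| == 1.
  rewrite cardsCs setCK card_ord cardsU uv0 cards0 subn0.
  rewrite (eqP (valP u)) (eqP (valP v)).
  case: n n_gt0 {u v dis uv0 Eb} => // n _.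
  by rewrite mul2n -addnn addSn addnS /= !subn1 /= subSnn.
case/cards1P=> a Ea; exists a; rewrite /edge_labeled Eb Ea; split=> // b.
by move/eqP/set1_inj.
Qed.

(* A walk v_0 v_1 ... v_k is given by its start v_0 and the sequence          *)
(* p = [:: v_1; ...; v_k], so its length is size p.                           *)
Definition is_walk (n k : nat) (x y : odd_vertex n) (p : seq (odd_vertex n)) :
    bool :=
  [&& path (@odd_adj n) x p, last x p == y & size p == k].

Definition walk_edges (n : nat) (x : odd_vertex n) (p : seq (odd_vertex n)) :
    seq {set odd_vertex n} :=
  pairmap (@edge n) x p.

Definition is_special_walk (n k : nat) (x y : odd_vertex n)
    (p : seq (odd_vertex n)) : bool :=
  is_walk k x y p && sorted (fun e f => e != f) (walk_edges x p).

(* Main.v *)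
Require Import Defs.
From mathcomp Require Import all_boot zify.

Set Implicit Arguments.
Unset Strict Implicit.
Unset Printing Implicit Defensive.

(** A walk is determined by its start and its edge labels: following the label
    [a] from [v] leads to the complement of [a |: v], and two consecutive edges
    are distinct exactly when their labels are.  Two consecutive steps, with
    labels [a] and [r], therefore replace [v] by [(a |: v) :\ r].  Thus a special
    walk of even length amounts to a sequence of exchanges on [n]-element sets,
    each removing one element and adding a new one, in which the element just
    added is never the next one to be removed.  A walk of length [2 * k + 2] with
    first label [lambda1] and last label [lambda2] corresponds to [k] exchanges
    from [A = lambda1 |: w0] to [B = lambda2 |: wl1], where the first one does not
    remove [lambda1] and the last one does not add [lambda2].

    Such a sequence exists whenever [k >= 3] and [#|A :\: B| <= k]
    ([exchangeable_ge3]).  For larger [k], one exchange, towards [B] unless [A] is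
    already close to [B], reduces the claim to [k - 1].  For [k = 3] the first
    exchange is chosen so that [A] and [B] then differ in exactly two elements, or
    in one if they were equal, and the last two exchanges are explicit.  Since
    [A] and [B] are [n]-subsets of a set with [2 * n - 1] elements, [#|A :\: B|]
    is at most [n - 1], so [k = n - 1] is always possible and gives the walks of
    length exactly [2 * n].  The hypothesis [n >= 4] ensures that [n - 1 >= 3], and
    also that the auxiliary elements needed for [k = 3], common to [A] and [B] or
    outside both, exist.  Longer walks, of either parity, follow by prepending
    edges one at a time: after the prescribed first edge, any other label can come
    second. *)

(** * Exchanges on finite sets *)

Definition exchange {T : finType} (A : {set T}) (r p : T) : {set T} :=
  p |: (A :\ r).

(** [a] is the most recently added element, which may not be removed at once;
    the last element added has to differ from [b]. *)
Fixpoint exchangeable {T : finType} (k : nat) (A : {set T}) (a : T)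
    (B : {set T}) (b : T) : Prop :=
  if k is k'.+1 then
    exists r p, [/\ r \in A, r != a, p \notin A &
                    exchangeable k' (exchange A r p) p B b]
  else A = B /\ a != b.

Section Exchanges.

Context {T : finType}.
Implicit Types (A B X : {set T}) (a b r p u v x : T) (k : nat).

Lemma exists_neq X a : 1 < #|X| -> exists2 x, x \in X & x != a.
Proof.
move=> X_gt1; have : 0 < #|X :\ a| by move: (cardsD1 a X); lia.
by case/card_gt0P=> x /setD1P[xa xX]; exists x.
Qed.

Lemma exists_neq2 X a b :
  2 < #|X| -> exists x, [/\ x \in X, x != a & x != b].
Proof.
move=> X_gt2; have : 1 < #|X :\ a| by move: (cardsD1 a X); lia.
by case/(@exists_neq _ b)=> x /setD1P[xa xX] xb; exists x.
Qed.

Lemma card_exchange A r p :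
  r \in A -> p \notin A -> #|exchange A r p| = #|A|.
Proof.
move=> rA pA; rewrite /exchange cardsU1 !inE (negbTE pA) andbF.
by rewrite (cardsD1 r A) rA.
Qed.

Lemma card_exchangeD A B r p : r \in A -> p \notin A ->
  #|exchange A r p :\: B| + (r \notin B) = #|A :\: B| + (p \notin B).
Proof.
move=> rA pA.
have -> : #|A :\: B| = (r \notin B) + #|(A :\: B) :\ r|.
  by rewrite (cardsD1 r) !inE rA andbT.
have -> : #|exchange A r p :\: B| = (p \notin B) + #|(A :\: B) :\ r|.
  case: (boolP (p \in B)) => pB /=.
    rewrite add0n; apply: eq_card => x; rewrite !inE.
    by case: eqVneq => [->|_]; rewrite ?pB ?andbF //= andbCA.
  have -> : exchange A r p :\: B = p |: ((A :\: B) :\ r).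
    apply/setP=> x; rewrite !inE.
    by case: eqVneq => [->|_] /=; rewrite ?pB // andbCA.
  by rewrite cardsU1 !inE (negbTE pA) !andbF.
lia.
Qed.

Lemma cardsD_sym A B : #|A| = #|B| -> #|B :\: A| = #|A :\: B|.
Proof. by move=> AB; rewrite !cardsD AB setIC. Qed.

Lemma exchangeable1 A a B b u v : #|A| = #|B| -> #|A :\: B| = 1 ->
  u \in A :\: B -> u != a -> v \in B :\: A -> v != b ->
  exchangeable 1 A a B b.
Proof.
move=> cAB d1 /setDP[uA uB] ua /setDP[vB vA] vb.
exists u, v; split=> //; split=> //.
have := card_exchangeD B uA vA; rewrite d1 uB vB => d0.
apply/eqP; rewrite eqEcard card_exchange // cAB leqnn andbT.
by rewrite -setD_eq0 -cards_eq0; apply/eqP; lia.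
Qed.

Lemma exchangeable2_dist2 A a B b : #|A| = #|B| -> #|A :\: B| = 2 ->
  exchangeable 2 A a B b.
Proof.
move=> cAB d2; have d2' := cardsD_sym cAB.
have [|u1 /setDP[u1A u1B] u1a] := @exists_neq (A :\: B) a; first by lia.
have [|u2 /setDP[u2A u2B] u21] := @exists_neq (A :\: B) u1; first by lia.
(* The element added last is chosen first: it is the one that must avoid b. *)
have [|v2 /setDP[v2B v2A] v2b] := @exists_neq (B :\: A) b; first by lia.
have [|v1 /setDP[v1B v1A] v12] := @exists_neq (B :\: A) v2; first by lia.
exists u1, v1; split=> //.
apply: (@exchangeable1 _ _ _ _ u2 v2) => //.
- by rewrite card_exchange.
- by have := card_exchangeD B u1A v1A; rewrite u1B v1B; lia.
- by rewrite !inE u2B u2A u21 orbT.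
- by apply: contraNneq u2B => ->.
- by rewrite !inE (negbTE v2A) v2B eq_sym (negbTE v12) andbF.
Qed.

(** At distance one, a common element [z] is removed temporarily: it makes room
    for the missing element and takes the place of the superfluous one. *)
Lemma exchangeable2_dist1 A a B b : #|A| = #|B| -> #|A :\: B| = 1 ->
  2 < #|A :&: B| -> exchangeable 2 A a B b.
Proof.
move=> cAB d1 common; have d1' := cardsD_sym cAB.
have /card_gt0P[u /setDP[uA uB]] : 0 < #|A :\: B| by lia.
have /card_gt0P[v /setDP[vB vA]] : 0 < #|B :\: A| by lia.
have [z [/setIP[zA zB] za zb]] := @exists_neq2 _ a b common.
have vz : v != z by apply: contraNneq vA => ->.
exists z, v; split=> //.
apply: (@exchangeable1 _ _ _ _ u z) => //.
- by rewrite card_exchange.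
- by have := card_exchangeD B zA vA; rewrite zB vB; lia.
- have uz : u != z by apply: contraNneq uB => ->.
  by rewrite !inE uB uA uz orbT.
- by apply: contraNneq uB => ->.
- by rewrite !inE eqxx zB eq_sym (negbTE vz).
Qed.

(** The first exchange moves to distance two, where the last two exchanges always
    exist: towards [B] from distance three, sideways from distance two, away from
    [B] from distance one.  From distance zero only distance one can be reached,
    and there the many common elements help. *)
Lemma exchangeable3 A a B b :
  #|A| = #|B| -> 3 < #|A| -> #|A| + 2 < #|T| -> #|A :\: B| <= 3 ->
  exchangeable 3 A a B b.
Proof.
move=> cAB A_gt3 T_gt d_le3; have dC := cardsD_sym cAB.
have cAI := cardsID B A; have cU := cardsU A B; have cC := cardsC (A :|: B).
have card_new r p : r \in A -> p \notin A -> #|exchange A r p| = #|B|.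
  by move=> rA pA; rewrite card_exchange.
have outside : #|A :\: B| < 3 -> exists2 x, x \notin A & x \notin B.
  move=> d_lt3; have : 0 < #|~: (A :|: B)| by lia.
  by case/card_gt0P=> x; rewrite !inE negb_or => /andP[xA xB]; exists x.
have [d_gt1|d_le1] := ltnP 1 #|A :\: B|.
  have [u /setDP[uA uB] ua] := @exists_neq _ a d_gt1.
  have [p pA pB] : exists2 p, p \notin A & (p \notin B) = (#|A :\: B| == 2).
    have [d2|d_neq2] := eqVneq #|A :\: B| 2.
      by have [|x xA xB] := outside; [lia | exists x].
    have /card_gt0P[v /setDP[vB vA]] : 0 < #|B :\: A| by lia.
    by exists v; rewrite ?vB.
  exists u, p; split=> //; apply: exchangeable2_dist2; first exact: card_new.
  by have := card_exchangeD B uA pA; rewrite uB pB; case: eqP; lia.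
have [|x xA xB] := outside; first by lia.
have [|z /setIP[zA zB] za] := @exists_neq (A :&: B) a; first by lia.
have := card_exchangeD B zA xA; rewrite zB xB => d_new.
exists z, x; split=> //; have cE := card_new _ _ zA xA.
have [d1|d0] := eqVneq #|A :\: B| 1.
  by apply: exchangeable2_dist2 => //; lia.
apply: exchangeable2_dist1 => //; first by lia.
by have := cardsID B (exchange A z x); lia.
Qed.

Lemma exchangeable_ge3 k A a B b :
  #|A| = #|B| -> 3 < #|A| -> #|A| + 2 < #|T| -> 2 < k -> #|A :\: B| <= k ->
  exchangeable k A a B b.
Proof.
elim: k A a => // k IH A a cAB A_gt3 T_gt k_gt2 d_le.
have [k2|k_neq2] := eqVneq k 2.
  by rewrite k2 in d_le *; exact: exchangeable3.
suff [r [p [rA ra pA d_new]]] : exists r p,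
    [/\ r \in A, r != a, p \notin A & #|exchange A r p :\: B| <= k].
  by exists r, p; split=> //; apply: IH; rewrite ?card_exchange //; lia.
have [d_gt1|d_le1] := ltnP 1 #|A :\: B|.
  have [u /setDP[uA uB] ua] := @exists_neq _ a d_gt1.
  have /card_gt0P[v /setDP[vB vA]] : 0 < #|B :\: A| by rewrite cardsD_sym //; lia.
  exists u, v; split=> //.
  by have := card_exchangeD B uA vA; rewrite uB vB; lia.
(* Any exchange increases the distance by at most one, to at most 2 <= k. *)
have [|r rA ra] := @exists_neq A a; first by lia.
have /card_gt0P[p] : 0 < #|~: A| by have := cardsC A; lia.
rewrite inE => pA; exists r, p; split=> //.
by have := card_exchangeD B rA pA; case: (r \in B); case: (p \in B) => /=; lia.
Qed.

End Exchanges.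

(** * Special walks with prescribed first and last labels *)

Section Walks.

Context {n : nat}.
Implicit Types (u v w : odd_vertex n) (a b c : 'I_(2 * n - 1)).

Definition labeled_special_walk (L : nat) v a w b : Prop :=
  exists p, [/\ is_special_walk L v w p,
                edge_labeled (head set0 (walk_edges v p)) a &
                edge_labeled (last set0 (walk_edges v p)) b].

Lemma edge_labeledE u v a :
  edge_labeled (edge u v) a = (~: (vset u :|: vset v) == [set a]).
Proof.
rewrite /edge_labeled; congr (~: _ == _).
apply/setP=> i; apply/bigcupP/setUP => [[x /set2P[]-> xi]|[ui|vi]].
- by left.
- by right.
- by exists u; rewrite // set21.
- by exists v; rewrite // set22.
Qed.

Lemma card_vset v : #|vset v| = n - 1.
Proof. exact/eqP/(valP v). Qed.

Lemma label_step v a :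
  a \notin vset v -> exists u, vset u = ~: (a |: vset v).
Proof.
move=> av; have cu : #|~: (a |: vset v)| == n - 1.
  have := cardsC (a |: vset v); rewrite cardsU1 av card_vset card_ord.
  by have := ltn_ord a; lia.
by exists (exist (fun A : {set 'I_(2 * n - 1)} => #|A| == n - 1) _ cu).
Qed.

Lemma label_step_adj v a u : vset u = ~: (a |: vset v) -> odd_adj v u.
Proof. by move=> Eu; rewrite /odd_adj disjoints_subset Eu setCK subsetUr.
Qed.

Lemma label_step_labeled v a u :
  a \notin vset v -> vset u = ~: (a |: vset v) -> edge_labeled (edge v u) a.
Proof.
move=> av Eu; rewrite edge_labeledE Eu; apply/eqP/setP=> i; rewrite !inE.
by case: eqVneq => [->|_]; rewrite ?(negbTE av) //= orbN.
Qed.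

Lemma labeled_special_walk1 v a u :
  a \notin vset v -> vset u = ~: (a |: vset v) ->
  labeled_special_walk 1 v a u a.
Proof.
move=> av Eu; exists [:: u]; rewrite /is_special_walk /is_walk /= eqxx.
by rewrite (label_step_adj Eu) label_step_labeled.
Qed.

(** Distinct labels force distinct edges, because an edge has only one label. *)
Lemma labeled_special_walk_cons L v a u b w c :
  a \notin vset v -> vset u = ~: (a |: vset v) -> a != b ->
  labeled_special_walk L.+1 u b w c -> labeled_special_walk L.+2 v a w c.
Proof.
move=> av Eu ab [[|x p] [/andP[/and3P[//= walk end_w size_p] special]]] /=.
move=> first_b last_c; exists [:: u, x & p]; split=> //=.
  rewrite /is_special_walk /is_walk /= (label_step_adj Eu) end_w.
  rewrite -eqSS in size_p; rewrite size_p; case/andP: walk => -> -> /=.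
  move: special; rewrite /= => ->; rewrite andbT.
  apply: contraNneq ab => eq_edges.
  have := label_step_labeled av Eu; rewrite eq_edges.
  move: first_b; rewrite /edge_labeled => /eqP-> /eqP/set1_inj->.
  by rewrite eqxx.
exact: label_step_labeled.
Qed.

(** Each exchange becomes two edges: the first one is labeled by the element added
    just before the exchange, the second one by the element that it removes.  The
    element that it adds is the label of the edge that follows. *)
Lemma exchangeable_walk k v a w b :
  a \notin vset v -> b \notin vset w ->
  exchangeable k (a |: vset v) a (b |: vset w) b ->
  labeled_special_walk (2 * k).+2 v a w b.
Proof.
elim: k v a => [|k IH] v a av bw /=.
  case=> Eab ab; have [u Eu] := label_step av.
  apply: (labeled_special_walk_cons av Eu ab).
  apply: labeled_special_walk1; first by rewrite Eu Eab !inE eqxx.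
  by rewrite Eu Eab setCU setCK setIC -setDE setU1K.
case=> r [p [rA ra pA walk]]; have [u Eu] := label_step av.
have ru : r \notin vset u by rewrite Eu inE rA.
have [u' Eu'] := label_step ru.
have Eu'E : vset u' = (a |: vset v) :\ r.
  by rewrite Eu' Eu setCU setCK setIC -setDE.
have pu' : p \notin vset u' by rewrite Eu'E in_setD1 (negbTE pA) andbF.
have rp : r != p by apply: contraNneq pA => <-.
rewrite mulnS; rewrite eq_sym in ra.
apply: (labeled_special_walk_cons av Eu ra).
apply: (labeled_special_walk_cons ru Eu' rp).
by apply: IH => //; rewrite Eu'E.
Qed.

Lemma labeled_special_walk_2n v a w b :
  3 < n -> a \notin vset v -> b \notin vset w ->
  labeled_special_walk (2 * n) v a w b.
Proof.
move=> n_gt3 av bw; have -> : 2 * n = (2 * (n - 1)).+2 by lia.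
apply: exchangeable_walk => //.
have cA : #|a |: vset v| = n by rewrite cardsU1 av card_vset; lia.
have cB : #|b |: vset w| = n by rewrite cardsU1 bw card_vset; lia.
apply: exchangeable_ge3; rewrite ?cA ?cB ?card_ord //; try lia.
have := subset_leq_card (subsetDr (a |: vset v) (b |: vset w)).
by have := cardsC (b |: vset w); rewrite cB card_ord; lia.
Qed.

End Walks.

Theorem theorem2p3 (n l : nat) (hn : 4 <= n) (hl : 2 * n - 1 <= l)
    (w0 wl1 : odd_vertex n) (lambda1 lambda2 : 'I_(2 * n - 1))
    (h1 : lambda1 \notin vset w0) (h2 : lambda2 \notin vset wl1) :
  exists p : seq (odd_vertex n),
    [/\ is_special_walk l.+1 w0 wl1 p,
        edge_labeled (head set0 (walk_edges w0 p)) lambda1 &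
        edge_labeled (last set0 (walk_edges w0 p)) lambda2].
Proof.
rewrite -/(labeled_special_walk l.+1 w0 lambda1 wl1 lambda2).
elim: l hl w0 lambda1 h1 => [|l IH] hl w0 lambda1 h1; first by lia.
have [l_2n|l_neq] := eqVneq l.+2 (2 * n).
  by rewrite l_2n; exact: labeled_special_walk_2n.
have [u Eu] := label_step h1.
have [|b bu b1] := @exists_neq _ (~: vset u) lambda1.
  by have := cardsC (vset u); rewrite card_vset card_ord; lia.
rewrite inE in bu; rewrite eq_sym in b1.
apply: (labeled_special_walk_cons h1 Eu b1).
by apply: IH => //; lia.
Qed.
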